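(* Let $\langle \mathcal{P},T\rangle$ be an $EPT$ representation of a graph $G$. If $G$ has a $k$-gate as an induced subgraph, then $\langle \mathcal{P},T\rangle$ contains a multipie of size $k$ whose paths are in one-to-one correspondence with the vertices of the gate (the path $P_v$ corresponding to the vertex $v$).
   Context: All graphs are finite and simple. An $EPT$ representation of a graph $G$ is a pair $\langle \mathcal{P},T\rangle$ where $T$ is a tree and $\mathcal{P}=(P_v)_{v\in V(G)}$ is a family of subpaths of $T$ such that two distinct vertices $v,w$ are adjacent if and only if $E(P_v)\cap E(P_w)\neq\emptyset$. A clique is a maximal complete set of vertices. Gates are defined recursively: (i) every chordless cycle $C_n$ with $n\geq 4$ is a gate; (ii) if $H$ is a gate, $C$ and $C'$ are disjoint cliques of $H$, and $P=(v_1,\dots,v_l)$ with $l\geq 2$ is a chordless path vertex-disjoint from $H$, then the union of $H$ and $P$ together with all edges between $v_1$ and the vertices of $C$ and all edges between $v_l$ and the vertices of $C'$ is a gate; (iii) there are no other gates. A $k$-gate is a gate with exactly $k$ cliques. A star is a graph $K_{1,n}$; its edges are spokes; the claw is $K_{1,3}$. A path contains a spoke if the spoke is one of its edges. Three paths of $\mathcal{P}$ form a claw if there is a claw $Y$ subgraph of $T$ such that every pair of spokes of $Y$ is contained in one of the three paths. A multipie of size $k$ in $\langle\mathcal{P},T\rangle$ is a star subgraph of $T$ with center $q$ and neighbors $q_1,\dots,q_k$ together with a subfamily $\mathcal{P}'\subseteq\mathcal{P}$ such that: (1) every $P\in\mathcal{P}'$ satisfies $|V(P)\cap\{q_1,\dots,q_k\}|=2$;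 (2) for $i\neq j$, at most one $P\in\mathcal{P}'$ has $\{q_i,q_j\}\subseteq V(P)$; (3) for each $1\leq i\leq k$, at least two $P\in\mathcal{P}'$ have $\{q,q_i\}\subseteq V(P)$; (4) no three paths of $\mathcal{P}'$ form a claw. *)

(* Defs.v *)
From mathcomp Require Import all_boot.
Set Implicit Arguments. Unset Strict Implicit. Unset Printing Implicit Defensive.

(* A finite simple graph is a type V : finType with a symmetric irreflexive
   relation; the tree T is likewise W : finType with relation eT. *)

Section Defs.

Variables (W : finType) (eT : rel W).

Definition acyclic : Prop :=
  forall c : seq W, uniq c -> 2 < size c -> ~~ cycle eT c.

Definition is_tree : Prop :=
  symmetric eT /\ irreflexive eT /\ (forall x y, connect eT x y) /\ acyclic.

Definition tpath (p : seq W) : bool := [&& 0 < size p, uniq p & sorted eT p].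

Definition pedge (p : seq W) (a b : W) : bool :=
  ((a, b) \in zip p (behead p)) || ((b, a) \in zip p (behead p)).

Definition share_edge (p p' : seq W) : Prop :=
  exists a b, pedge p a b && pedge p' a b.

Variables (V : finType) (adj : rel V).

Definition EPT_rep (P : V -> seq W) : Prop :=
  is_tree /\ (forall v, tpath (P v)) /\
  (forall v w, v != w -> (adj v w <-> share_edge (P v) (P w))).

Definition complete (K : {set V}) : bool :=
  [forall x in K, forall y in K, (x != y) ==> adj x y].

Definition clique_of (S K : {set V}) : bool :=
  [&& K \subset S, complete K &
      [forall x in S :\: K, ~~ [forall y in K, adj x y]]].

Definition num_cliques (S : {set V}) : nat := #|[set K | clique_of S K]|.

Definition consec (s : seq V) (x y : V) : bool :=
  ((x, y) \in zip s (behead s)) || ((y, x) \in zip s (behead s)).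

Definition induced_cycle (S : {set V}) : Prop :=
  exists c : seq V, [/\ uniq c, 3 < size c, S = [set x in c] &
    forall x y, x \in c -> y \in c ->
      adj x y = consec (rcons c (head x c)) x y].

Inductive gate : {set V} -> Prop :=
| gate_cycle S : induced_cycle S -> gate S
| gate_ext (H C C' : {set V}) (p : seq V) :
    gate H ->
    clique_of H C -> clique_of H C' -> [disjoint C & C'] ->
    1 < size p -> uniq p -> [disjoint [set x in p] & H] ->
    (forall x y, x \in p -> y \in p -> adj x y = consec p x y) ->
    (forall x h, x \in p -> h \in H ->
       adj x h = ((x == head x p) && (h \in C)) || ((x == last x p) && (h \in C'))) ->
    gate (H :|: [set x in p]).

Definition form_claw (p1 p2 p3 : seq W) : Prop :=
  exists (c : W) (a : 'I_3 -> W),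
    injective a /\ (forall i, eT c (a i)) /\
    (forall i j : 'I_3, i != j ->
       [\/ pedge p1 c (a i) && pedge p1 c (a j),
           pedge p2 c (a i) && pedge p2 c (a j) |
           pedge p3 c (a i) && pedge p3 c (a j)]).

Definition multipie {k : nat} (q : W) (qs : 'I_k -> W)
    (P : V -> seq W) (S : {set V}) : Prop :=
  [/\ injective qs /\ (forall i, eT q (qs i)),
      (forall v, v \in S -> #|[set i | qs i \in P v]| = 2),
      (forall i j, i != j -> #|[set v in S | (qs i \in P v) && (qs j \in P v)]| <= 1),
      (forall i, 2 <= #|[set v in S | (q \in P v) && (qs i \in P v)]|) &
      (forall u v w, u \in S -> v \in S -> w \in S ->
         u != v -> v != w -> u != w -> ~ form_claw (P u) (P v) (P w))].

End Defs.

(* Main.v *)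
Require Import Defs.
From mathcomp Require Import all_boot zify.
Set Implicit Arguments. Unset Strict Implicit. Unset Printing Implicit Defensive.

(** Fix a vertex [q] of the tree and label each path [P v] with the set [F v] of
    branches of [T - q] that it enters. If all labels of a gate [S] have two elements,
    its paths all pass through [q], and two of them share an edge exactly when their
    labels meet. The multipie conditions then follow from three properties of gates,
    proved by induction: there are no true twins, every triangle [u v w] has a vertex
    adjacent to exactly one of [u, v, w], and every vertex has two nonadjacent
    neighbours. They also force the cliques of [S] to be the families of paths through
    a common spoke, so the pie has size [k].

    To find [q], view a cycle as a path attached to an edge [ab], like the paths attached
    in clause (ii) of the definition of gates, and let [q] be the vertex where [P a] and
    [P b] part on the side of the remaining paths. A chain of paths attached to two
    spokes at [q] cannot stay inside one branch: it could leave it only through a path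
    containing its spoke, which chordlessness forbids. Hence each path of the chain
    enters two branches, and [q] serves for the extended gate as well. *)

(** * Consecutive pairs of a sequence *)

Lemma zip_beheadP (T : eqType) (a b : T) s :
  reflect (exists s1 s2, s = s1 ++ [:: a, b & s2]) ((a, b) \in zip s (behead s)).
Proof.
apply: (iffP idP) => [|[s1 [s2 ->]]]; last first.
  elim: s1 => [|c s1 IH] /=; first by rewrite inE eqxx.
  by case: s1 IH => [|d s1] /= IH; rewrite inE IH orbT.
elim: s => [//|c [//|d s] IH]; rewrite inE => /orP[/eqP[-> ->]|].
  by exists [::], s.
by case/IH=> s1 [s2 ->]; exists (c :: s1), s2.
Qed.

Lemma zip_behead_mem (T : eqType) (s : seq T) x y :
  (x, y) \in zip s (behead s) -> (x \in s) && (y \in s).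
Proof.
by case/zip_beheadP=> s1 [s2 ->]; rewrite !mem_cat !inE !eqxx !orbT.
Qed.

(** * Branches of a tree at a vertex and the labels of its paths *)

Section Tree.
Variables (W : finType) (eT : rel W).
Hypothesis treeT : is_tree eT.

Let eT_sym : symmetric eT. Proof. by case: treeT. Qed.
Let eT_irr : irreflexive eT. Proof. by case: treeT => _ []. Qed.

Definition avoid q : rel W := fun a b => [&& eT a b, a != q & b != q].
Arguments avoid q a b /.

(** A branch of [T - q] is named by the neighbour of [q] in it. The vertex [q] names itself, and the
    default of [odflt] is never reached because the tree is connected. *)
Definition branch q w : W :=
  if w == q then q else odflt q [pick x | eT q x && connect (avoid q) x w].

Definition branches q (p : seq W) : {set W} :=
  [set branch q w | w in [pred w in p | w != q]].

Lemma edge_neq a b : eT a b -> a != b.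
Proof. by move=> ab; apply: contraTneq ab => ->; rewrite eT_irr. Qed.

Lemma connect_avoid_sym q : connect_sym (avoid q).
Proof. by apply: sym_connect_sym => a b /=; rewrite eT_sym [(a != q) && _]andbC. Qed.

Lemma path_avoid q x s : path eT x s -> q \notin x :: s -> path (avoid q) x s.
Proof.
elim: s x => //= y s IH x /andP[xy ys]; rewrite !inE !negb_or => /and3P[qx qy qs].
by rewrite xy eq_sym qx eq_sym qy IH // inE negb_or qy.
Qed.

Lemma connect_avoid_neq q x w : x != q -> connect (avoid q) x w -> w != q.
Proof.
move=> xq /connectP[s]; case/lastP: s => [|s z]; first by move=> _ ->.
by rewrite rcons_path last_rcons => /andP[_ /and3P[_ _ zq]] ->.
Qed.

(** A duplicate-free walk from [x] to [y] off [q] with at least one edge would close up through [q]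
    to a cycle of length at least three. *)
Lemma avoid_uniq q x y :
  eT q x -> eT q y -> connect (avoid q) x y -> x = y.
Proof.
move=> qx qy /connectP[s0 xs0 ys0]; case: (shortenP xs0) ys0 => s xs us _ ys.
case: s xs us ys => [//|z s] xs us ys.
have uc: uniq (q :: x :: z :: s).
  rewrite cons_uniq us andbT inE negb_or edge_neq //=.
  elim: (z :: s) (x) xs {us ys} => //= a r IH c /andP[/and3P[_ _ aq]] /IH.
  by rewrite inE negb_or eq_sym aq.
have [_ [_ [_ /(_ _ uc isT)/negP[]]]] := treeT.
have xs': path eT x (z :: s) by apply: sub_path xs => a b /and3P[].
by rewrite (cycle_path q) [last _ _](esym ys) [path _ _ _]/= eT_sym qy qx.
Qed.

Lemma branchqq q : branch q q = q. Proof. by rewrite /branch eqxx. Qed.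

Lemma branchP q w : w != q -> eT q (branch q w) /\ connect (avoid q) (branch q w) w.
Proof.
move=> wq; rewrite /branch (negPf wq); case: pickP => [x /andP[]//|no].
have [_ [_ [/(_ q w)/connectP[s0 qs0 ws0] _]]] := treeT.
case: (shortenP qs0) ws0 => s qs us _ ws.
case: s qs us ws => [|x s] qs us ws; first by rewrite ws eqxx in wq.
have /andP[qx xs] : eT q x && path eT x s by [].
have /negP[] := no x; rewrite qx /=; apply/connectP; exists s => //.
by apply: path_avoid => //; case/andP: us.
Qed.

Lemma branch_eq q x w : eT q x -> connect (avoid q) x w -> branch q w = x.
Proof.
move=> qx xw; have wq: w != q by apply: connect_avoid_neq xw; rewrite eq_sym edge_neq.
have [qb bw] := branchP wq; apply: avoid_uniq qb qx _.
by apply: connect_trans bw _; rewrite connect_avoid_sym.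
Qed.

Lemma branch_nbr q x : eT q x -> branch q x = x.
Proof. by move=> qx; apply: branch_eq. Qed.

(** Deleting the edge between [q] and [y] splits the tree in two, and both sides of the equation ask
    whether [w] is in the part of [q]. *)
Lemma branch_flip q y w : eT q y -> (branch y w == q) = (branch q w != y).
Proof.
move=> qy; have yq := edge_neq qy.
have [->|wq] := eqVneq w q; first by rewrite branchqq yq branch_nbr ?eqxx // eT_sym.
have [->|wy] := eqVneq w y; first by rewrite branchqq eq_sym (negPf yq) branch_nbr // eqxx.
have [qx /connectP[s xs ws]] := branchP wq; set x := branch q w in qx xs ws *.
have [xy|xy] := eqVneq x y.
  (* A walk from [q] to [w] avoiding [y] would put [w] in a branch of [q] other than [y]. *)
  apply/negP=> /eqP byw; have [_] := branchP wy; rewrite byw.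
  case/connectP=> s0 qs0; case: (shortenP qs0) => {qs0}{}s0 qs0 us0 _.
  case: s0 qs0 us0 => [|z s0] /=; first by move=> _ _ wq'; rewrite wq' eqxx in wq.
  case/andP=> /and3P[qz _ zy] zs0 /andP[qs0 _] ws0.
  have: branch q w = z.
    apply: branch_eq => //; apply/connectP; exists s0 => //.
    apply: path_avoid => //; apply: sub_path zs0 => a b /and3P[] //.
  by move=> bz; rewrite -bz -/x xy eqxx in zy.
(* The edge from [q] to [x], continued inside the branch [x], reaches [w] and misses [y], which lies
   in another branch. *)
apply/eqP/branch_eq; first by rewrite eT_sym.
apply: (@connect_trans _ _ x); first by apply: connect1; rewrite /= qx yq.
apply/connectP; exists s => //; apply: path_avoid.
  by apply: sub_path xs => a b /and3P[].
apply/negP=> /(path_connect xs) xcy.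
by rewrite -(branch_eq qx xcy) branch_nbr // eqxx in xy.
Qed.

Lemma pedge_mem (p : seq W) a b : pedge p a b -> (a \in p) && (b \in p).
Proof.
by case/orP=> /zip_behead_mem //; rewrite andbC.
Qed.

Lemma pedge_edge p a b : tpath eT p -> pedge p a b -> eT a b.
Proof.
case/and3P=> _ _ sp; case/orP=> /zip_beheadP[s1 [s2 def]]; move: sp; rewrite def.
  by move/cat_sorted2=> [_ /= /andP[]].
by move/cat_sorted2=> [_ /= /andP[]]; rewrite eT_sym.
Qed.

Lemma branch_const q x s w :
  path eT x s -> q \notin x :: s -> w \in x :: s -> branch q w = branch q x.
Proof.
move=> xs qs ws; have xq: x != q by apply: contraNneq qs => ->; rewrite mem_head.
have [qb bx] := branchP xq; apply: branch_eq => //; apply: connect_trans bx _.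
exact: path_connect (path_avoid xs qs) _ ws.
Qed.

Lemma branches_off q p : tpath eT p -> q \notin p -> #|branches q p| <= 1.
Proof.
case: p => [//|x s] /and3P[_ _ /= xs] qp.
rewrite -(cards1 (branch q x)); apply/subset_leq_card/subsetP => z /imsetP[w /andP[ws _] ->].
by rewrite inE (branch_const xs qp).
Qed.

Lemma branch_head q s w :
  path eT q s -> q \notin s -> w \in s -> branch q w = head q s.
Proof.
case: s => //= x s /andP[qx xs] qs ws.
by rewrite (branch_const xs qs ws) branch_nbr.
Qed.

(** The path splits at [q] into two arms, and each stays in the branch of its first vertex. So the
    labels are exactly the ends of spokes at [q] that the path contains. *)
Lemma branches_on q p : tpath eT p -> q \in p ->
  #|branches q p| <= 2 /\ (forall z, z \in branches q p -> pedge p q z).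
Proof.
move=> /and3P[_ up sp] qp; case/splitPr: qp up sp => p1 p2.
rewrite cat_uniq /= => /and4P[_ /norP[qp1 _] qp2 _] sp.
have sp2: path eT q p2 by case/cat_sorted2: sp.
have sp1: path eT q (rev p1).
  move: sp; rewrite -cat_rcons => /cat_sorted2[+ _].
  rewrite -[rcons p1 q]revK rev_sorted rev_rcons /=.
  by apply: sub_path => a b; rewrite eT_sym.
have br w : w \in p1 ++ q :: p2 -> w != q ->
    w \in rev p1 /\ branch q w = head q (rev p1) \/
    w \in p2 /\ branch q w = head q p2.
  rewrite mem_cat inE => + wq; rewrite (negPf wq) /= => /orP[w1|w2].
    by left; rewrite mem_rev (branch_head sp1) ?mem_rev.
  by right; rewrite (branch_head sp2).
split=> [|z /imsetP[w /andP[wp wq] ->]].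
  apply: leq_trans (_ : #|[set head q (rev p1); head q p2]| <= _); last first.
    by rewrite cards2; case: (_ != _).
  apply/subset_leq_card/subsetP => z /imsetP[w /andP[wp wq] ->].
  by case: (br w wp wq) => [[_ ->]|[_ ->]]; rewrite !inE eqxx ?orbT.
case: (br w wp wq) => [[w1 ->]|[w2 ->]].
  apply/orP; right; apply/zip_beheadP.
  case/lastP: p1 w1 {qp1 sp sp1 br wp} => // s a _.
  by rewrite rev_rcons /=; exists s, p2; rewrite cat_rcons.
apply/orP; left; apply/zip_beheadP.
by case: p2 w2 {qp2 sp sp2 br wp} => // a s _; exists p1, s.
Qed.

Lemma branches_le2 q p : tpath eT p -> #|branches q p| <= 2.
Proof.
move=> tp; have [qp|qp] := boolP (q \in p); first by case: (branches_on tp qp).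
exact: leq_trans (branches_off tp qp) _.
Qed.

Lemma mem_branches q p w : w \in p -> w != q -> branch q w \in branches q p.
Proof. by move=> wp wq; apply/imsetP; exists w => //; apply/andP. Qed.

Lemma branches_nbr q p z : z \in branches q p -> eT q z.
Proof. by case/imsetP=> w /andP[_ wq] ->; case: (branchP wq). Qed.

(** A shared edge has an end different from [q], and both paths enter its branch, whether or not
    they pass through [q]. *)
Lemma branches_share q p p' : tpath eT p -> share_edge p p' ->
  exists2 z, z \in branches q p & z \in branches q p'.
Proof.
move=> tp [a [b /andP[ab ab']]]; have e := pedge_edge tp ab.
have [/andP[ap bp] /andP[ap' bp']] := (pedge_mem ab, pedge_mem ab').
have [aq|aq] := eqVneq a q.
  by exists (branch q b); apply: mem_branches; rewrite // eq_sym -aq edge_neq.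
by exists (branch q a); apply: mem_branches.
Qed.

Lemma share_branches q p p' z : tpath eT p -> tpath eT p' ->
  q \in p -> q \in p' -> z \in branches q p -> z \in branches q p' ->
  share_edge p p'.
Proof.
move=> tp tp' qp qp' zp zp'; exists q, z.
by rewrite (branches_on tp qp).2 ?(branches_on tp' qp').2.
Qed.

End Tree.

(** * Ears, and three properties that all gates have *)

Section Graph.
Variables (V : finType) (adj : rel V).
Hypotheses (adj_sym : symmetric adj) (adj_irr : irreflexive adj).
Implicit Types (S H C K : {set V}) (p : seq V).

Definition twin_free S := forall u v, u \in S -> v \in S -> adj u v ->
  exists t, [/\ t \in S, t != u, t != v & adj t u != adj t v].

Definition triangles_split S := forall u v w, u \in S -> v \in S -> w \in S ->
  adj u v -> adj v w -> adj u w ->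
  exists2 t, t \in S & adj t u + adj t v + adj t w = 1.

Definition nonsimplicial S := forall v, v \in S -> exists s t,
  [/\ s \in S, t \in S & [&& adj s v, adj t v, s != t & ~~ adj s t]].

(** The attachment of clause (ii), except that the feet [C] and [C'] are merely nonempty disjoint
    subsets of [H]. In this form it also covers a cycle, built on one of its edges. *)
Record ear (H C C' : {set V}) (p : seq V) : Prop := Ear {
  ear_size : 1 < size p;
  ear_uniq : uniq p;
  ear_disj : [disjoint [set x in p] & H];
  ear_path : forall x y, x \in p -> y \in p -> adj x y = consec p x y;
  ear_att : forall x h, x \in p -> h \in H ->
    adj x h = ((x == head x p) && (h \in C)) || ((x == last x p) && (h \in C'));
  ear_feet : [disjoint C & C'];
  ear_sub : C \subset H;
  ear_sub' : C' \subset H;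
  ear_foot : exists c, c \in C;
  ear_foot' : exists c, c \in C' }.

Lemma zip_behead_nth (d : V) p i j : uniq p -> i < size p -> j < size p ->
  ((nth d p i, nth d p j) \in zip p (behead p)) = (i.+1 == j).
Proof.
move=> up ip jp; have sz : size (zip p (behead p)) = (size p).-1.
  by rewrite size_zip size_behead (minn_idPr (leq_pred _)).
apply/(nthP (d, d))/eqP => [[m]|ij].
  rewrite sz nth_zip_cond sz => mp; have mp' : m.+1 < size p by move: mp ip; case: (size p).
  by rewrite mp nth_behead => -[/eqP + /eqP]; rewrite !nth_uniq // ?(ltnW mp') //; lia.
have ip' : i < (size p).-1 by move: jp; rewrite -ij; case: (size p).
by exists i; rewrite ?nth_zip_cond sz // ip' nth_behead ij.
Qed.

Lemma consec_nth (d : V) p i j : uniq p -> i < size p -> j < size p ->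
  consec p (nth d p i) (nth d p j) = (i.+1 == j) || (j.+1 == i).
Proof. by move=> up ip jp; rewrite /consec !zip_behead_nth. Qed.

Section Ear.
Variables (H C C' : {set V}) (p : seq V).
Hypothesis E : ear H C C' p.

Variable d : V.
Let l := size p.
Local Notation v := (nth d p).

Let l2 : 1 < l := ear_size E.

Lemma ear_nth_eq i j : i < l -> j < l -> (v i == v j) = (i == j).
Proof. by move=> il jl; rewrite nth_uniq ?(ear_uniq E). Qed.

Lemma ear_nth x : x \in p -> exists2 i, i < l & x = v i.
Proof. by move=> xp; exists (index x p); rewrite ?index_mem ?nth_index. Qed.

Lemma ear_mem i : i < l -> v i \in p. Proof. exact: mem_nth. Qed.

Lemma ear_adj i j : i < l -> j < l -> adj (v i) (v j) = (i.+1 == j) || (j.+1 == i).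
Proof.
by move=> il jl; rewrite (ear_path E) ?mem_nth // consec_nth // (ear_uniq E).
Qed.

Lemma ear_adjH i h : i < l -> h \in H ->
  adj (v i) h = ((i == 0) && (h \in C)) || ((i.+1 == l) && (h \in C')).
Proof.
move=> il hH; rewrite (ear_att E) ?mem_nth //.
rewrite -nth0 -nth_last !(set_nth_default d) //; try by move: l2; rewrite /l; case: (size p).
rewrite -/l !ear_nth_eq //; lia.
Qed.

Lemma ear_adjC i c : i < l -> c \in C -> adj (v i) c = (i == 0).
Proof.
move=> il cC; rewrite ear_adjH ?(subsetP (ear_sub E)) // cC.
by rewrite (disjointFr (ear_feet E) cC) !andbF andbT orbF.
Qed.

Lemma ear_adjC' i c : i < l -> c \in C' -> adj (v i) c = (i.+1 == l).
Proof.
move=> il cC; rewrite ear_adjH ?(subsetP (ear_sub' E)) // cC.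
by rewrite (disjointFl (ear_feet E) cC) !andbF andbT.
Qed.

Lemma ear_adjP h i : h \in H -> i < l -> adj h (v i) ->
  h \in C /\ i = 0 \/ h \in C' /\ i.+1 = l.
Proof.
move=> hH il; rewrite adj_sym ear_adjH //.
by case/orP=> /andP[/eqP ? ?]; [left|right].
Qed.

Lemma ear_neq i h : i < l -> h \in H -> h != v i.
Proof.
move=> il hH; apply: contraTneq hH => ->.
by rewrite (disjointFr (ear_disj E)) // inE ear_mem.
Qed.

Let S := H :|: [set x in p].

Lemma ear_caseP x : x \in S -> x \in H \/ exists2 i, i < l & x = v i.
Proof. by rewrite !inE => /orP[|/ear_nth]; [left|right]. Qed.

Let SH x : x \in H -> x \in S. Proof. by rewrite inE => ->. Qed.
Let Sv i : i < l -> v i \in S. Proof. by move=> il; rewrite !inE ear_mem ?orbT. Qed.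

(** The witnesses are the vertices before and after [v i] on the way from one foot through the path
    to the other foot. *)
Lemma ear_nonsimplicial i : i < l -> exists s t,
  [/\ s \in S, t \in S & [&& adj s (v i), adj t (v i), s != t & ~~ adj s t]].
Proof.
move=> il; have [[c cC] [c' cC']] := (ear_foot E, ear_foot' E).
have cH := subsetP (ear_sub E) c cC; have cH' := subsetP (ear_sub' E) c' cC'.
have [i0|i0] := eqVneq i 0.
  exists c, (v 1); split; [exact: SH|exact: Sv|].
  by rewrite ear_neq // ![adj c _]adj_sym !(ear_adjC _ cC) // ear_adj // i0.
have [ie|ie] := eqVneq i.+1 l.
  have il' : i.-1 < l by lia.
  exists c', (v i.-1); split; [exact: SH|exact: Sv|].
  by rewrite ear_neq // ![adj c' _]adj_sym !(ear_adjC' _ cC') // ear_adj //; lia.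
have [il1 il2] : i.-1 < l /\ i.+1 < l by lia.
exists (v i.-1), (v i.+1); split; try exact: Sv.
by rewrite !ear_adj ?ear_nth_eq //; lia.
Qed.

(** Here [v i] is an end of the path. Its neighbour on the path does not see [h], because the feet
    are disjoint. *)
Lemma ear_twin_free_HP h i : h \in H -> i < l -> adj h (v i) ->
  exists t, [/\ t \in S, t != h, t != v i & adj t h != adj t (v i)].
Proof.
move=> hH il /(ear_adjP hH il) [] [hC ie].
  exists (v 1); rewrite Sv // eq_sym ear_neq // ear_nth_eq // ear_adj //.
  by rewrite (ear_adjC _ hC) // ie.
have il' : i.-1 < l by lia.
exists (v i.-1); rewrite Sv // eq_sym ear_neq // ear_nth_eq // ear_adj //.
by rewrite (ear_adjC' _ hC) //; split => //; lia.
Qed.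

Lemma ear_twin_free_PP i j : i < l -> j < l -> adj (v i) (v j) ->
  exists t, [/\ t \in S, t != v i, t != v j & adj t (v i) != adj t (v j)].
Proof.
wlog ij : i j / i.+1 = j => [th il jl|il jl _].
  move=> a; move: (a); rewrite ear_adj // => /orP[]/eqP e; first exact: th.
  rewrite adj_sym in a; have [t [tS ti tj te]] := th j i e jl il a.
  by exists t; split; rewrite // eq_sym.
(* The vertex before [v i], taken in the foot [C] if [i = 0], sees [v i] but not its successor. *)
have [i0|i0] := eqVneq i 0.
  have [c cC] := ear_foot E; have cH := subsetP (ear_sub E) c cC.
  exists c; rewrite SH ?ear_neq // ![adj c _]adj_sym !(ear_adjC _ cC) //.
  by split => //; lia.
have il' : i.-1 < l by lia.
exists (v i.-1); rewrite Sv // !ear_nth_eq // !ear_adj //.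
by split => //; lia.
Qed.

(** Only pairs inside [H] remain to be checked, and their witness may lie on the path: the base edge
    of a cycle has no witness of its own. *)
Lemma ear_twin_free :
  (forall u v, u \in H -> v \in H -> adj u v ->
     exists t, [/\ t \in S, t != u, t != v & adj t u != adj t v]) -> twin_free S.
Proof.
move=> tH u w /ear_caseP[uH|[i il ->]] /ear_caseP[wH|[j jl ->]] a.
- exact: tH.
- exact: ear_twin_free_HP.
- rewrite adj_sym in a; have [t [? ? ? te]] := ear_twin_free_HP wH il a.
  by exists t; split; rewrite // eq_sym.
- exact: ear_twin_free_PP.
Qed.

(** Both [u] and [w] lie in the foot at the end [v i], so the next vertex of the path sees [v i]
    alone. *)
Lemma ear_split_HHP u w i : u \in H -> w \in H -> i < l ->
  adj u (v i) -> adj w (v i) ->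
  exists2 t, t \in S & adj t u + adj t w + adj t (v i) = 1.
Proof.
move=> uH wH il /(ear_adjP uH il) [] [uC ie] /(ear_adjP wH il) [] [wC ie'].
- by exists (v 1); rewrite ?Sv // (ear_adjC _ uC) // (ear_adjC _ wC) // ear_adj // ie.
- lia.
- lia.
have il' : i.-1 < l by lia.
by exists (v i.-1); rewrite ?Sv // (ear_adjC' _ uC) // (ear_adjC' _ wC) // ear_adj //; lia.
Qed.

(** A vertex of [H] sees no inner vertex of the path and, the feet being disjoint, at most one of
    its ends. *)
Lemma ear_split_HPP u i j : u \in H -> i < l -> j < l ->
  adj u (v i) -> adj u (v j) -> adj (v i) (v j) -> False.
Proof.
move=> uH il jl /(ear_adjP uH il) [] [uC ie] /(ear_adjP uH jl) [] [uC' je].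
- by rewrite ear_adj //; lia.
- by have := disjointFr (ear_feet E) uC; rewrite uC'.
- by have := disjointFr (ear_feet E) uC'; rewrite uC.
- by rewrite ear_adj //; lia.
Qed.

Lemma ear_triangles_split :
  (forall u v w, u \in H -> v \in H -> w \in H ->
    adj u v -> adj v w -> adj u w ->
    exists2 t, t \in S & adj t u + adj t v + adj t w = 1) -> triangles_split S.
Proof.
move=> tH x y z /ear_caseP[xH|[i il ->]] /ear_caseP[yH|[j jl ->]]
  /ear_caseP[zH|[k kl ->]] xy yz xz.
- exact: tH.
- exact: ear_split_HHP.
- have [|t tS te] := ear_split_HHP xH zH jl xy; first by rewrite adj_sym.
  by exists t; rewrite // -te addnAC.
- by case: (ear_split_HPP xH jl kl).
- have [||t tS te] := ear_split_HHP yH zH il; rewrite 1?adj_sym //.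
  by exists t; rewrite // -te -addnA addnC.
- by case: (ear_split_HPP yH il kl); rewrite // adj_sym.
- by case: (ear_split_HPP zH il jl); rewrite // adj_sym.
- by move: xy yz xz; rewrite !ear_adj //; lia.
Qed.

End Ear.

Lemma zip_behead_rcons (w a : V) s :
  zip (w :: rcons s a) (rcons s a) = rcons (zip (w :: s) s) (last w s, a).
Proof. by elim: s w => //= x s IH w; rewrite IH. Qed.

(** The first two vertices form the base edge and the others the path, which starts next to [b] and
    closes up at [a]. Length at least four leaves two vertices for the path. *)
Lemma induced_cycle_ear S : induced_cycle adj S -> exists a b p,
  [/\ adj a b, ear [set a; b] [set b] [set a] p & S = [set a; b] :|: [set x in p]].
Proof.
case=> -[|a [|b [|w s]]] [] // uc sc defS A.
have /and3P[abp bp up] := uc.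
have /norP[ab ap] : ~~ ((a == b) || (a \in w :: s)) by move: abp; rewrite inE.
have mp x : x \in w :: s -> x \in [:: a, b, w & s] /\ ((x == a) = false /\ (x == b) = false).
  move=> xp; split; first by rewrite 2!in_cons xp !orbT.
  by split; apply: contraTF xp => /eqP ->.
have zE x y : ((x, y) \in zip (rcons [:: a, b, w & s] a) (behead (rcons [:: a, b, w & s] a)))
    = [|| (x == a) && (y == b), (x == b) && (y == w), (x == last w s) && (y == a)
        | (x, y) \in zip (w :: s) s].
  have -> : zip (rcons [:: a, b, w & s] a) (behead (rcons [:: a, b, w & s] a)) =
    [:: (a, b), (b, w) & zip (w :: rcons s a) (rcons s a)] by [].
  by rewrite zip_behead_rcons 2!in_cons mem_rcons in_cons !xpair_eqE.
have zF x y : (x == a) || (x == b) || (y == a) || (y == b) ->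
    ((x, y) \in zip (w :: s) s) = false.
  move=> h; apply: contraTF h => /zip_behead_mem/andP[/mp[_ [-> ->]] /mp[_ [-> ->]]].
  by [].
have AE x y : x \in [:: a, b, w & s] -> y \in [:: a, b, w & s] ->
    adj x y = consec (rcons [:: a, b, w & s] a) x y by move=> xc yc; rewrite A.
exists a, b, (w :: s); split.
- by rewrite AE ?inE ?eqxx ?orbT // /consec zE !eqxx.
- split=> //.
  + rewrite disjoint_sym disjoints_subset; apply/subsetP => x.
    by rewrite !inE => /orP[] /eqP ->; rewrite ?(negPf ap) ?(negPf bp).
  + move=> x y xp yp; have [[xc [xa xb]] [yc [ya yb]]] := (mp x xp, mp y yp).
    by rewrite AE // /consec !zE xa xb ya yb !andbF.
  + move=> x h xp; have [xc [xa xb]] := mp x xp.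
    rewrite !inE => /orP[]/eqP ->; rewrite AE ?inE ?eqxx ?orbT //.
      by rewrite /consec !zE !zF ?eqxx ?orbT // xa xb (negPf ab) /= !andbT !andbF !orbF.
    rewrite /consec !zE !zF ?eqxx ?orbT // xa xb [b == a]eq_sym (negPf ab) /=.
    by rewrite !andbT !andbF !orbF.
  + by rewrite disjoints1 inE eq_sym.
  + by rewrite sub1set !inE eqxx orbT.
  + by rewrite sub1set !inE eqxx.
  + by exists b; rewrite inE.
  + by exists a; rewrite inE.
- by rewrite defS; apply/setP => x; rewrite !inE orbA.
Qed.

Lemma clique_neq0 S K : (exists x, x \in S) -> clique_of adj S K -> exists x, x \in K.
Proof.
case=> x xS /and3P[_ _ /forall_inP mK]; apply/set0Pn; apply: contraTneq (xS) => K0.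
have := mK x; rewrite K0 setD0 => h; apply/negP => /h/forall_inP[] y.
by rewrite inE.
Qed.

Lemma gate_ext_ear H C C' p : (exists x, x \in H) ->
    clique_of adj H C -> clique_of adj H C' -> [disjoint C & C'] ->
    1 < size p -> uniq p -> [disjoint [set x in p] & H] ->
    (forall x y, x \in p -> y \in p -> adj x y = consec p x y) ->
    (forall x h, x \in p -> h \in H ->
       adj x h = ((x == head x p) && (h \in C)) || ((x == last x p) && (h \in C'))) ->
  ear H C C' p.
Proof.
move=> H0 cC cC'; split=> //; try exact: clique_neq0 H0 _.
  by case/and3P: cC.
by case/and3P: cC'.
Qed.

Lemma gate_props S : gate adj S ->
  [/\ exists x, x \in S, twin_free S, triangles_split S & nonsimplicial S].
Proof.
elim=> {S} [S /induced_cycle_ear[a [b [p [ab E ->]]]]|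
  H C C' p gH [H0 twH trH nsH] cC cC' CC' sp up pH adjp adjpH].
  have ne_ab : a != b by apply: contraTneq ab => ->; rewrite adj_irr.
  have [aH bH] : a \in [set a; b] /\ b \in [set a; b] by rewrite !inE !eqxx orbT.
  have l0 : 0 < size p by apply: ltnW (ear_size E).
  have hS : nth a p 0 \in [set a; b] :|: [set x in p] by rewrite !inE mem_nth ?orbT.
  have l1 : (size p).-1 < size p by rewrite ltn_predL.
  have lS : nth a p (size p).-1 \in [set a; b] :|: [set x in p].
    by rewrite !inE mem_nth ?orbT.
  (* In a cycle the first vertex of the path sees only [b] on the base edge and the last one only
     [a]. They serve as witnesses for the base. *)
  have hb : adj (nth a p 0) b by rewrite (ear_adjC E) // inE.
  have ha : ~~ adj (nth a p 0) a.
    by rewrite (ear_adjC' E) // ?inE //; have := ear_size E; lia.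
  have la : adj (nth a p (size p).-1) a.
    by rewrite (ear_adjC' E) // ?inE //; have := ear_size E; lia.
  have lb : ~~ adj (nth a p (size p).-1) b.
    by rewrite (ear_adjC E) // ?inE //; have := ear_size E; lia.
  split.
  - by exists a; rewrite !inE eqxx.
  - apply: (ear_twin_free E a) => u v; rewrite !inE => /orP[]/eqP-> /orP[]/eqP->;
      rewrite ?adj_irr // => _; exists (nth a p 0); rewrite hS.
      by rewrite ![nth _ _ _ == _]eq_sym !(ear_neq E) // hb (negPf ha).
    by rewrite ![nth _ _ _ == _]eq_sym !(ear_neq E) // hb (negPf ha).
  - apply: (ear_triangles_split E a) => u v w; rewrite !inE.
    by move=> /orP[]/eqP-> /orP[]/eqP-> /orP[]/eqP->; rewrite ?adj_irr.
  - move=> v /(ear_caseP a)[|[i il ->]]; last exact: (ear_nonsimplicial E a il).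
    rewrite !inE => /orP[]/eqP->.
      exists b, (nth a p (size p).-1); split=> //; first by rewrite inE bH.
      by rewrite adj_sym ab la (ear_neq E) //= adj_sym.
    exists a, (nth a p 0); split=> //; first by rewrite inE aH.
    by rewrite ab hb (ear_neq E) //= adj_sym.
have E := gate_ext_ear H0 cC cC' CC' sp up pH adjp adjpH.
have [d dH] := H0; have SH x : x \in H -> x \in H :|: [set x in p].
  by rewrite inE => ->.
split.
- by exists d; apply: SH.
- apply: (ear_twin_free E d) => u v uH vH /(twH u v uH vH)[t [tH tu tv te]].
  by exists t; rewrite SH.
- apply: (ear_triangles_split E d) => u v w uH vH wH uv vw uw.
  by have [t tH te] := trH u v w uH vH wH uv vw uw; exists t; rewrite ?SH.
- move=> v /(ear_caseP d)[vH|[i il ->]]; last exact: (ear_nonsimplicial E d il).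
  by have [s [t [sH tH st]]] := nsH v vH; exists s, t; rewrite !SH.
Qed.

End Graph.

(** * Two-element sets *)

Section Pairs.
Variable X : finType.
Implicit Types (A B : {set X}) (x y z : X).

Lemma card_ge2P A : 1 < #|A| -> exists x y, [/\ x \in A, y \in A & x != y].
Proof. by case/card_gt1P=> x [y []]; exists x, y. Qed.

Lemma card_ge2 A x y : x \in A -> y \in A -> x != y -> 1 < #|A|.
Proof. by move=> xA yA xy; apply/card_gt1P; exists x, y. Qed.

Lemma pairE A x y : #|A| <= 2 -> x \in A -> y \in A -> x != y -> A = [set x; y].
Proof.
move=> A2 xA yA xy; apply/esym/eqP; rewrite eqEcard cards2 xy A2 andbT.
by apply/subsetP => z; rewrite !inE => /orP[]/eqP ->.
Qed.

Lemma pair_other A x : #|A| = 2 -> x \in A -> exists2 y, y != x & A = [set x; y].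
Proof.
move=> A2 xA; have [] := @card_ge2P A; first by rewrite A2.
move=> a [b [aA bA ab]]; have [xa|xa] := eqVneq a x.
  by exists b; [rewrite eq_sym -xa | apply: pairE; rewrite ?A2 // -xa].
by exists a => //; apply: pairE; rewrite ?A2 // eq_sym.
Qed.

Lemma meet_pair A x y : (A :&: [set x; y] != set0) = (x \in A) || (y \in A).
Proof.
apply/set0Pn/idP => [[z]|].
  by rewrite !inE => /andP[zA /orP[]/eqP <-]; rewrite zA ?orbT.
by case/orP=> [xA|yA]; [exists x|exists y]; rewrite !inE eqxx ?xA ?yA ?orbT.
Qed.

End Pairs.

(** * Gates whose labels all have two elements: cliques are spokes *)

Section Spokes.
Variables (V X : finType) (adj : rel V) (F : V -> {set X}) (S : {set V}).
Hypotheses (adj_sym : symmetric adj) (adj_irr : irreflexive adj).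
Hypothesis F2 : forall v, v \in S -> #|F v| = 2.
Hypothesis adjF : forall u v, u \in S -> v \in S -> u != v ->
  adj u v = (F u :&: F v != set0).
Hypotheses (twS : twin_free adj S) (trS : triangles_split adj S)
  (nsS : nonsimplicial adj S).

Lemma spokes_adj u v z : u \in S -> v \in S -> u != v ->
  z \in F u -> z \in F v -> adj u v.
Proof.
by move=> uS vS uv zu zv; rewrite adjF //; apply/set0Pn; exists z; rewrite inE zu.
Qed.

(** Adjacency depends on labels only, so distinct vertices with equal labels would be true twins. *)
Lemma spokes_inj u v : u \in S -> v \in S -> F u = F v -> u = v.
Proof.
move=> uS vS uv; apply/eqP/negPn/negP => ne.
have a: adj u v by rewrite adjF // uv setIid -card_gt0 F2.
have [t [tS tu tv]] := twS uS vS a.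
by rewrite !adjF // uv eqxx.
Qed.

(** Of two nonadjacent neighbours of [v], one must contain [z]: otherwise both contain the other
    element of [F v] and are adjacent. *)
Lemma spokes_other v z : v \in S -> z \in F v ->
  exists w, [/\ w \in S, w != v & z \in F w].
Proof.
move=> vS zv; have [s [t [sS tS /and4P[sv tv st nst]]]] := nsS vS.
have [y _ Fv] := pair_other (F2 vS) zv.
have ne r : adj r v -> r != v by apply: contraTneq => ->; rewrite adj_irr.
have [zs|zs] := boolP (z \in F s); first by exists s; rewrite ne.
have [zt|zt] := boolP (z \in F t); first by exists t; rewrite ne.
have ys : y \in F s by move: (sv); rewrite adjF ?ne // Fv meet_pair (negPf zs).
have yt : y \in F t by move: (tv); rewrite adjF ?ne // Fv meet_pair (negPf zt).
by rewrite (spokes_adj sS tS st ys yt) in nst.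
Qed.

Lemma spokes_pair v x y : v \in S -> x \in F v -> y \in F v -> x != y ->
  F v = [set x; y].
Proof. by move=> vS; apply: pairE; rewrite (F2 vS). Qed.

Lemma spokes_meet1 u v x y : u \in S -> v \in S -> x != y ->
  x \in F u -> y \in F u -> x \in F v -> y \in F v -> u = v.
Proof.
move=> uS vS xy xu yu xv yv; apply: spokes_inj => //.
by rewrite (spokes_pair uS xu yu xy) (spokes_pair vS xv yv xy).
Qed.

(** The three vertices would form a triangle. A further label containing one of [x], [y], [z] meets
    at least two of the three pairs, so no vertex sees exactly one corner. *)
Lemma spokes_no_claw u v w x y z : u \in S -> v \in S -> w \in S ->
  x != y -> y != z -> z != x -> F u = [set x; y] -> F v = [set y; z] ->
  F w = [set z; x] -> False.
Proof.
move=> uS vS wS xy yz zx Fu Fv Fw.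
have neF r s t : t \in F r -> t \notin F s -> r != s.
  by move=> tr; apply: contraNneq => <-.
have uv : u != v.
  by apply: (neF _ _ x); rewrite ?Fu ?Fv !inE ?eqxx // negb_or xy eq_sym.
have vw : v != w.
  by apply: (neF _ _ y); rewrite ?Fv ?Fw !inE ?eqxx // negb_or yz eq_sym.
have uw : u != w.
  by apply: (neF _ _ y); rewrite ?Fu ?Fw !inE ?eqxx ?orbT // negb_or yz eq_sym.
have auv : adj u v by rewrite adjF // Fv meet_pair Fu !inE eqxx ?orbT.
have avw : adj v w by rewrite adjF // Fw meet_pair Fv !inE eqxx ?orbT.
have auw : adj u w by rewrite adjF // Fw meet_pair Fu !inE eqxx ?orbT.
have [t tS] := trS uS vS wS auv avw auw.
have [->|tu] := eqVneq t u; first by rewrite adj_irr auv auw.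
have [->|tv] := eqVneq t v; first by rewrite adj_irr [adj v u]adj_sym auv avw.
have [->|tw] := eqVneq t w; first by rewrite adj_irr ![adj w _]adj_sym auw avw.
rewrite !adjF // Fu Fv Fw !meet_pair.
by case: (x \in F t); case: (y \in F t); case: (z \in F t).
Qed.

Definition star x : {set V} := [set v in S | x \in F v].

(** For maximality, suppose [t] misses [x] but meets two members with labels [x y] and [x z]. Then
    its label is [y z], and the three form a claw. *)
Lemma star_clique v x : v \in S -> x \in F v -> clique_of adj S (star x).
Proof.
move=> vS xv; have [w [wS wv xw]] := spokes_other vS xv; apply/and3P; split.
- by apply/subsetP => t; rewrite inE => /andP[].
- apply/forall_inP => s; rewrite inE => /andP[sS xs].
  apply/forall_inP => t; rewrite inE => /andP[tS xt]; apply/implyP => st.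
  exact: spokes_adj xs xt.
apply/forall_inP => t; rewrite !inE => /andP[+ tS]; rewrite tS /= => xt.
apply/negP => /forall_inP at_; have [y yx Fv] := pair_other (F2 vS) xv.
have [z zx Fw] := pair_other (F2 wS) xw.
have tv: t != v by apply: contraNneq xt => ->.
have tw: t != w by apply: contraNneq xt => ->.
have yt : y \in F t.
  by have := at_ v; rewrite inE vS xv adjF // Fv meet_pair (negPf xt) => /(_ isT).
have zt : z \in F t.
  by have := at_ w; rewrite inE wS xw adjF // Fw meet_pair (negPf xt) => /(_ isT).
have yz : y != z.
  apply: contraNneq wv => yz; apply/eqP/spokes_inj => //.
  by rewrite Fv Fw yz.
apply: (@spokes_no_claw v t w x y z) => //; first by rewrite eq_sym.
  exact: spokes_pair.
by rewrite Fw setUC.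
Qed.

(** Pairwise meeting pairs have a common element or contain the three sides of a triangle, and the
    latter is a claw. *)
Lemma clique_star K : (exists x, x \in S) -> clique_of adj S K ->
  exists v x, [/\ v \in S, x \in F v & K = star x].
Proof.
move=> S0 cK; have [u uK] := clique_neq0 S0 cK.
case/and3P: cK => /subsetP KS /forall_inP cK /forall_inP mK.
have uS := KS u uK.
(* Once a common spoke is found, maximality of [K] gives the whole star. *)
suff [x xu Kx] : exists2 x, x \in F u & forall v, v \in K -> x \in F v.
  exists u, x; split=> //; apply/eqP; rewrite eqEsubset; apply/andP; split.
    by apply/subsetP => v vK; rewrite inE KS ?Kx.
  apply/subsetP => v; rewrite inE => /andP[vS xv]; apply: contraT => vK.
  have vSK : v \in S :\: K by rewrite inE vK.
  case/negP: (mK v vSK); apply/forall_inP => w wK; apply: (spokes_adj vS (KS w wK) _ xv (Kx w wK)).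
  by apply: contraNneq vK => ->.
have meetK v w : v \in K -> w \in K -> v != w -> F v :&: F w != set0.
  move=> vK wK vw; rewrite -adjF ?KS //.
  by have /forall_inP/(_ w wK)/implyP/(_ vw) := cK v vK.
have [x [y [xu yu xy]]] : exists x y, [/\ x \in F u, y \in F u & x != y].
  by apply: card_ge2P; rewrite (F2 uS).
have Fu : F u = [set x; y] by apply: spokes_pair.
have [/forall_inP allx|] := boolP [forall v in K, x \in F v]; first by exists x.
have [/forall_inP ally|] := boolP [forall v in K, y \in F v]; first by exists y.
case/forall_inPn=> w wK yw /forall_inPn[v vK xv]; exfalso.
have vu : v != u by apply: contraNneq xv => ->.
have wu : w != u by apply: contraNneq yw => ->.
have yv : y \in F v by have := meetK v u vK uK vu; rewrite Fu meet_pair (negPf xv).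
have xw : x \in F w.
  by have := meetK w u wK uK wu; rewrite Fu meet_pair (negPf yw) orbF.
have [z zy Fv] := pair_other (F2 (KS v vK)) yv.
have vw : v != w by apply: contraNneq yw => <-.
have zw : z \in F w.
  by have := meetK w v wK vK; rewrite eq_sym Fv meet_pair (negPf yw) => /(_ vw).
have zx : z != x by apply: contraNneq xv => <-; rewrite Fv !inE eqxx orbT.
apply: (@spokes_no_claw u v w x y z); rewrite ?KS //; first by rewrite eq_sym.
by apply: spokes_pair; rewrite ?KS.
Qed.

Definition used_spokes : {set X} := [set x | [exists v in S, x \in F v]].

(** A used spoke lies on two paths, and distinct paths cannot have two spokes in common. *)
Lemma star_inj : {in used_spokes &, injective star}.
Proof.
move=> x y; rewrite !inE => /exists_inP[v vS xv] _ exy.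
apply/eqP/negPn/negP => xy; have [w [wS wv xw]] := spokes_other vS xv.
have vy : v \in star y by rewrite -exy inE vS.
have wy : w \in star y by rewrite -exy inE wS.
move: vy wy; rewrite !inE => /andP[_ yv] /andP[_ yw].
by have /eqP := spokes_meet1 wS vS xy xw yw xv yv; rewrite (negPf wv).
Qed.

Lemma num_cliques_spokes : (exists x, x \in S) -> num_cliques adj S = #|used_spokes|.
Proof.
move=> S0; rewrite /num_cliques -(card_in_imset star_inj); congr #|pred_of_set _|.
apply/setP => K; rewrite inE; apply/idP/imsetP => [/(clique_star S0)[v [x [vS xv ->]]]|].
  by exists x => //; rewrite inE; apply/exists_inP; exists v.
by case=> x; rewrite inE => /exists_inP[v vS xv] ->; apply: star_clique xv.
Qed.

End Spokes.

(** * Chordless chains of paths between two spokes, with [Q v] for [P v] passing through the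
    centre *)

Section EarLift.
Variables (V X : finType) (adj : rel V) (F : V -> {set X}) (Q : pred V).
Hypothesis F_off : forall v, ~~ Q v -> #|F v| <= 1.
Hypothesis F_le2 : forall v, #|F v| <= 2.
Hypothesis F_adj : forall u v z, u != v -> Q u -> Q v -> z \in F u -> z \in F v -> adj u v.
Hypothesis adj_F : forall u v, adj u v -> exists2 z, z \in F u & z \in F v.

Lemma F_on v : #|F v| = 2 -> Q v.
Proof. by move=> v2; apply: contraT => /F_off; rewrite v2. Qed.

Lemma off_eq v x z : ~~ Q v -> x \in F v -> z \in F v -> x = z.
Proof.
move=> /F_off v1 xv zv; apply: contraTeq v1 => xz.
by rewrite -ltnNge (card_ge2 xv zv).
Qed.

(* A chain of overlapping paths can enter or leave the branch [z] only through a path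
   containing the spoke of [z]. *)
Lemma chain_trapped z a s : path adj a s ->
  (forall r, r \in a :: s -> ~~ (Q r && (z \in F r))) ->
  (z \in F a) = (z \in F (last a s)).
Proof.
elim: s a => //= b s IH a /andP[ab bs] noQ.
rewrite -IH // => [|r rs]; last by apply: noQ; rewrite inE rs orbT.
have [x xa xb] := adj_F ab; have := noQ a; have := noQ b; rewrite !inE !eqxx orbT.
move=> /(_ isT) nb /(_ isT) na; apply/idP/idP => [za|zb].
  have nQ: ~~ Q a by apply: contra na => ->.
  by rewrite (off_eq nQ za xa).
have nQ: ~~ Q b by apply: contra nb => ->.
by rewrite (off_eq nQ zb xb).
Qed.

Lemma consec_tail (w w' : V) s : uniq [:: w, w' & s] ->
  (forall x y, x \in [:: w, w' & s] -> y \in [:: w, w' & s] ->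
     adj x y = consec [:: w, w' & s] x y) ->
  [/\ adj w w', forall r, r \in s -> ~~ adj w r &
    forall x y, x \in w' :: s -> y \in w' :: s -> adj x y = consec (w' :: s) x y].
Proof.
case/andP=> wn un A.
have cE x y : consec [:: w, w' & s] x y =
  [|| (x == w) && (y == w'), (y == w) && (x == w') | consec (w' :: s) x y].
  rewrite /consec [zip _ _]/= !in_cons !xpair_eqE -!orbA; congr (_ || _).
  by rewrite orbCA.
have wF y : (consec (w' :: s) w y) = false.
  apply: contraNF wn; rewrite /consec => /orP[] /zip_behead_mem /andP[]; by [].
split=> [|r rs|x y xs ys].
- by rewrite A ?cE ?inE ?eqxx ?orbT.
- rewrite A ?cE ?wF ?inE ?eqxx ?rs ?orbT // orbF negb_or.
  have wr : r != w'.
    by apply: contraTneq rs => ->; case/andP: un.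
  by rewrite (negPf wr) andbF /=; apply/nandP; left; apply: contraNneq wn => <-; rewrite inE rs orbT.
- rewrite A ?cE 1?inE ?xs ?ys ?orbT //.
  have -> : x == w = false by apply: contraNF wn => /eqP <-.
  by have -> : y == w = false by apply: contraNF wn => /eqP <-.
Qed.

Lemma consec_path (w : V) s : uniq (w :: s) ->
  (forall x y, x \in w :: s -> y \in w :: s -> adj x y = consec (w :: s) x y) ->
  path adj w s.
Proof.
elim: s w => //= w' s IH w uw A; have [-> _ A'] := consec_tail uw A.
by apply: IH => //; case/andP: uw.
Qed.

(** The chain starts in the branch [z] and has to leave it to meet [t]. A member after [w]
    containing the spoke [z] would be adjacent to [u], so the exit happens at [w], which thus enters
    a second branch. The argument then restarts from [w]. *)
Lemma ear_lift s w u z t : #|F t| = 2 -> z \notin F t ->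
  Q u -> z \in F u -> z \in F w -> uniq (w :: s) -> u \notin w :: s ->
  t \notin w :: s ->
  (forall x y, x \in w :: s -> y \in w :: s -> adj x y = consec (w :: s) x y) ->
  adj (last w s) t -> (forall r, r \in w :: s -> r != last w s -> ~~ adj r t) ->
  (forall r, r \in s -> ~~ adj u r) ->
  forall r, r \in w :: s -> #|F r| = 2.
Proof.
move=> t2; elim: s w u z => [|w' s IH] w u z zt Qu zu zw us uws tws A wt nt nu r.
  rewrite inE => /eqP ->; have [x xw xt] := adj_F wt.
  have xz : x != z by apply: contraNneq zt => <-.
  by apply/eqP; rewrite eqn_leq F_le2 (card_ge2 xw zw xz).
have noQ r' : r' \in rcons (w' :: s) t -> ~~ (Q r' && (z \in F r')).
  rewrite mem_rcons inE => /orP[/eqP ->|rs]; first by rewrite (negPf zt) andbF.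
  apply: contra (nu r' rs) => /andP[Qr zr]; apply: F_adj zu zr => //.
  by apply: contraNneq uws => ->; rewrite inE rs orbT.
have [ww' nw A'] := consec_tail us A.
have us' : uniq (w' :: s) by case/andP: us.
have pt : path adj w (rcons (w' :: s) t) by rewrite rcons_path (consec_path us A).
(* If [w] missed the centre, no member would contain the spoke [z], and the chain would be trapped
   up to [t]. *)
have Qw : Q w.
  apply: contraT => Qw; have e : (z \in F w) = (z \in F t).
    rewrite -(last_rcons w (w' :: s) t); apply: chain_trapped pt _ => r'.
    by rewrite inE => /orP[/eqP ->|/noQ //]; rewrite (negPf Qw).
  by rewrite -e zw in zt.
have zw' : z \notin F w'.
  have /= /andP[_ pt'] := pt; rewrite (chain_trapped (z := z) pt') ?last_rcons //.
have [x xw xw'] := adj_F ww'.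
have xz : x != z by apply: contraNneq zw' => <-.
have w2 : #|F w| = 2 by apply/eqP; rewrite eqn_leq F_le2 (card_ge2 xw zw xz).
(* Now [w] takes the role of [u] and the spoke [x] that of [z]. The label of [t] misses [x] because
   [w] and [t] are not adjacent. *)
rewrite inE => /orP[/eqP -> //|]; apply: (IH w' w x) => //.
- have: ~~ adj w t.
    apply: nt; rewrite ?mem_head //; apply/eqP => /= wl.
    by case/andP: us => /negP[]; rewrite wl mem_last.
  apply: contra => xt; apply: F_adj xw xt => //; last exact: F_on.
  by apply: contraNneq tws => <-; rewrite mem_head.
- by case/andP: us.
- by apply: contra tws => h; rewrite inE h orbT.
- by move=> r' rs; apply: nt; rewrite inE rs orbT.
Qed.

End EarLift.

(** * Labels in an EPT representation, and extension of a gate by a path *)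

Section Representation.
Variables (V : finType) (adj : rel V) (W : finType) (eT : rel W) (P : V -> seq W).
Hypotheses (adj_sym : symmetric adj) (adj_irr : irreflexive adj).
Hypothesis hEPT : EPT_rep eT adj P.

Let treeT : is_tree eT. Proof. by case: hEPT. Qed.
Let pathP v : tpath eT (P v). Proof. by case: hEPT => _ []. Qed.
Let adjP u v : u != v -> (adj u v <-> share_edge (P u) (P v)).
Proof. by case: hEPT => _ [_]; apply. Qed.

Local Notation F q v := (branches eT q (P v)).

Lemma rep_off q v : ~~ (q \in P v) -> #|F q v| <= 1.
Proof. exact: branches_off. Qed.

Lemma rep_le2 q v : #|F q v| <= 2.
Proof. exact: branches_le2. Qed.

Lemma rep_adj q u v z : u != v -> q \in P u -> q \in P v ->
  z \in F q u -> z \in F q v -> adj u v.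
Proof. by move=> uv qu qv zu zv; apply: (adjP uv).2; exact: share_branches zu zv. Qed.

Lemma adj_rep q u v : adj u v -> exists2 z, z \in F q u & z \in F q v.
Proof.
move=> uv; have ne : u != v by apply: contraTneq uv => ->; rewrite adj_irr.
by apply: branches_share => //; exact: (adjP ne).1.
Qed.

Lemma rep_mem q v z : q \in P v -> z \in F q v -> z \in P v.
Proof.
by move=> qv /(branches_on treeT (pathP v) qv).2 /pedge_mem /andP[].
Qed.

Lemma mem_rep q v z : eT q z -> z \in P v -> z \in F q v.
Proof.
move=> qz zv; rewrite -(branch_nbr treeT qz).
by apply: mem_branches => //; rewrite eq_sym (edge_neq treeT).
Qed.

Lemma rep_adjE q (S : {set V}) : (forall v, v \in S -> #|F q v| = 2) ->
  forall u v, u \in S -> v \in S -> u != v ->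
  adj u v = (F q u :&: F q v != set0).
Proof.
move=> F2 u v uS vS uv; apply/idP/set0Pn => [/(adj_rep q)[z zu zv]|[z]].
  by exists z; rewrite inE zu.
by rewrite inE => /andP[]; apply: rep_adj => //; apply: (F_on (@rep_off q)); apply: F2.
Qed.

Lemma ear_spokes q H C C' w s u t z : ear adj H C C' (w :: s) ->
  u \in C -> t \in C' -> q \in P u -> z \in F q u -> z \in F q w ->
  #|F q t| = 2 -> z \notin F q t -> forall r, r \in w :: s -> #|F q r| = 2.
Proof.
move=> E uC tC' qu zu zw t2 zt.
have uH := subsetP (ear_sub E) u uC; have tH := subsetP (ear_sub' E) t tC'.
have uC' := disjointFr (ear_feet E) uC; have tC := disjointFl (ear_feet E) tC'.
have out h : h \in H -> h \notin w :: s.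
  by move=> hH; apply: contraTN hH => hp; rewrite (disjointFr (ear_disj E)) ?inE.
apply: (ear_lift (@rep_off q) (@rep_le2 q) (@rep_adj q) (adj_rep q) t2 zt qu zu zw) => //.
- exact: ear_uniq E.
- exact: out.
- exact: out.
- exact: ear_path E.
- by rewrite (ear_att E) ?mem_last // tC' /= eqxx orbT.
- by move=> r rp rl; rewrite (ear_att E) // tC (negPf rl) andbF.
- move=> r rs; rewrite adj_sym (ear_att E) ?inE ?rs ?orbT // uC uC' andbF andbT orbF.
  by apply: contraTneq rs => /= ->; have /andP[] := ear_uniq E.
Qed.

(** The clique [C] is the star of a spoke [x], which [t] in [C'] misses, so by [ear_spokes] it is
    enough that the first path [w] enters the branch [x]. Otherwise [w] meets two members of [C] in
    distinct spokes [y1] and [y2], hence passes through [q]. *)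
Lemma gate_ext_spokes q (H C C' : {set V}) p :
  (exists x, x \in H) -> twin_free adj H -> triangles_split adj H ->
  nonsimplicial adj H -> (forall v, v \in H -> #|F q v| = 2) ->
  clique_of adj H C -> ear adj H C C' p -> forall r, r \in p -> #|F q r| = 2.
Proof.
move=> H0 twH trH nsH F2 cC; have adjF := rep_adjE F2.
case: p => [/ear_size //|w s E].
have [u1 [x [u1H xu1 CE]]] := clique_star adj_sym adj_irr F2 adjF trH H0 cC.
have u1C : u1 \in C by rewrite CE inE u1H.
have onH v : v \in H -> q \in P v by move=> /F2 /(F_on (@rep_off q)).
have [t tC'] := ear_foot' E; have tH := subsetP (ear_sub' E) t tC'.
have wC c : c \in C -> adj w c by move=> cC'; have := ear_adjC E w (i := 0) isT cC'.
apply: (ear_spokes E u1C tC' (onH _ u1H) xu1 _ (F2 _ tH)).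
  apply: contraT => xw.
  have [u2 [u2H u21 xu2]] := spokes_other adj_irr F2 adjF nsH u1H xu1.
  have u2C : u2 \in C by rewrite CE inE u2H.
  have [y1 y1w y1u] := adj_rep q (wC _ u1C).
  have [y2 y2w y2u] := adj_rep q (wC _ u2C).
  have y1x : x != y1 by apply: contraNneq xw => ->.
  have y12 : y1 != y2.
    apply: contraNneq u21 => y12; apply/eqP.
    by apply: (spokes_meet1 F2 adjF twH u2H u1H y1x xu2 _ xu1 y1u); rewrite y12.
  have qw : q \in P w.
    apply: (F_on (@rep_off q)); apply/eqP.
    by rewrite eqn_leq rep_le2 (card_ge2 y1w y2w).
  (* A second path of [H] through [y1] is adjacent to [w], hence in [C]. It then shares both [x] and
     [y1] with [u1]. *)
  have [r [rH ru1 y1r]] := spokes_other adj_irr F2 adjF nsH u1H y1u.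
  have rw : r != w := ear_neq E w (i := 0) isT rH.
  have /(ear_adjP adj_sym E (d := w) (i := 0) rH isT) : adj r w.
    by rewrite adj_sym; apply: (rep_adj _ qw _ y1w); rewrite 1?eq_sym ?onH.
  case=> -[rC le]; last by have := ear_size E; rewrite -le.
  have xr : x \in F q r by move: rC; rewrite CE inE => /andP[].
  by case/eqP: ru1; apply: (spokes_meet1 F2 adjF twH rH u1H y1x).
apply/negP => xt; have := disjointFl (ear_feet E) tC'.
by rewrite CE inE tH xt.
Qed.


(** * Locating the centre for a cycle *)

Lemma rep_opposite q y v : eT q y -> q \notin P v -> y \in F q v -> q \notin F y v.
Proof.
move=> qy qv yv; apply/negP => /imsetP[x /andP[xv _] /esym/eqP].
(* Such an [x] would lie outside the branch [y] at [q], but a path missing [q] stays in one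
   branch. *)
rewrite (branch_flip treeT) //= => /negP[]; apply/eqP.
apply: (@off_eq V W (fun u => F q u) (fun u => q \in P u) (@rep_off q) v) => //.
by apply: mem_branches => //; apply: contraNneq qv => <-.
Qed.

(** An edge common to [P a] and [P b], oriented with [e.1] facing [P w]: the part of the tree behind
    it, at [e.2], is not entered by [P w]. *)
Definition fork_spoke a b w (e : W * W) : bool :=
  [&& e.1 \in P a, e.1 \in P b, e.2 \in F e.1 a, e.2 \in F e.1 b & e.2 \notin F e.1 w].

(** No edge of [P a] is on [P w], so [P w] lies on one side of any edge shared by [P a] and [P b];
    this decides the orientation. *)
Lemma fork_spoke_exists a b w : adj a b -> a != w -> ~~ adj a w ->
  exists e, fork_spoke a b w e.
Proof.
move=> ab aw naw.
have ne : a != b by apply: contraTneq ab => ->; rewrite adj_irr.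
have [r [s /andP[ra rb]]] := (adjP ne).1 ab.
have rs := pedge_edge treeT (pathP a) ra.
have sr : eT s r by rewrite (treeT.1).
have [/andP[rA sA] /andP[rB sB]] := (pedge_mem ra, pedge_mem rb).
have [sw|sw] := boolP (s \in F r w); last first.
  exists (r, s); by rewrite /fork_spoke /= rA rB sw !mem_rep.
exists (s, r); rewrite /fork_spoke /= sA sB (mem_rep sr rA) (mem_rep sr rB) /=.
apply: rep_opposite => //; apply: contra naw => rw.
by apply: rep_adj rA rw _ sw => //; apply: mem_rep.
Qed.

(* Among the edges shared by [P a] and [P b] and pointing towards [P w], one with
   the largest branch behind it ends where [P a] and [P b] fork. *)
Lemma fork_center a b w : adj a b -> adj b w -> a != w -> ~~ adj a w ->
  exists q x, fork_spoke a b w (q, x) /\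
    forall y, y \in F q a -> y \in F q b -> y = x.
Proof.
move=> ab bw aw naw; have [e0 e0P] := fork_spoke_exists ab aw naw.
pose behind (e : W * W) := [set v | branch eT e.1 v == e.2].
case: (@arg_maxnP _ e0 (fork_spoke a b w) (fun e => #|behind e|) e0P) => -[q x] ex mx.
exists q, x; split=> // y ya yb; apply/eqP/negPn/negP => yx.
have /and5P[/= qa qb xa xb xw] := ex.
have qy := branches_nbr treeT ya; have yq : eT y q by rewrite (treeT.1).
have qx := branches_nbr treeT xa.
have [z zb zw] := adj_rep q bw.
have zy : z = y.
  have zx : z != x by apply: contraNneq xw => <-.
  by move: zb; rewrite (pairE (rep_le2 q b) xb yb) 1?eq_sym // !inE (negPf zx) => /eqP.
rewrite {z}zy in zb zw.
have qw : q \notin P w.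
  by apply: contra naw => qw; apply: rep_adj aw qa qw ya zw.
(* This shared edge also faces [P w], and behind it lie [q] and all that is behind [(q, x)], against
   the maximal choice. *)
have e' : fork_spoke a b w (y, q).
  rewrite /fork_spoke /= (rep_mem qa ya) (rep_mem qb yb) (mem_rep yq qa) (mem_rep yq qb) /=.
  exact: rep_opposite.
have := mx _ e'; rewrite /= leqNgt => /negP[]; apply/proper_card/properP; split.
  apply/subsetP => v; rewrite !inE /= => /eqP vx.
  by rewrite (branch_flip treeT) // vx eq_sym.
exists q; first by rewrite !inE /= (branch_nbr treeT yq).
by rewrite !inE /= branchqq (edge_neq treeT qx).
Qed.

(** Let [q] be the fork of [P a] and [P b] and [x] their only common spoke there. Neither end of the
    path enters the branch [x], so [b] meets [w] and [a] meets the last path in other spokes. This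
    gives [a] and [b] two labels each, and [ear_spokes] handles the rest. *)
Lemma cycle_spokes a b p : adj a b -> ear adj [set a; b] [set b] [set a] p ->
  exists q, forall v, v \in [set a; b] :|: [set x in p] -> #|F q v| = 2.
Proof.
case: p => [_ /ear_size //|w s] ab E.
have [aH bH] : a \in [set a; b] /\ b \in [set a; b] by rewrite !inE !eqxx orbT.
have neH h r : h \in [set a; b] -> r \in w :: s -> h != r.
  move=> hH; apply: contraTneq => <-; apply: contraTN hH => hp.
  by rewrite (disjointFr (ear_disj E)) ?inE.
have ne : a != b by apply: contraTneq ab => ->; rewrite adj_irr.
have adjA r : r \in w :: s -> adj r a = (r == last w s).
  by move=> rp; rewrite (ear_att E) // !inE eqxx (negPf ne) andbF andbT.
have adjB r : r \in w :: s -> adj r b = (r == w).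
  by move=> rp; rewrite (ear_att E) // !inE eqxx eq_sym [b == a]eq_sym (negPf ne) andbF andbT orbF eq_sym.
have wp : w \in w :: s by rewrite mem_head.
have lp : last w s \in w :: s by rewrite mem_last.
have wl : w != last w s.
  case: (s) (ear_size E) (ear_uniq E) => // c r _ /andP[wn _].
  by apply: contraNneq wn => /= ->; rewrite mem_last.
have [|||q [x [/and5P[/= qa qb xa xb xw] x1]]] := @fork_center a b w ab.
- by rewrite adj_sym adjB.
- exact: neH.
- by rewrite adj_sym adjA.
have [y yb yw] : exists2 y, y \in F q b & y \in F q w.
  by apply: adj_rep; rewrite adj_sym adjB.
have yx : y != x by apply: contraNneq xw => <-.
have ya : y \notin F q a by apply: contraNN yx => ya; rewrite (x1 y).
(* A path of the chain containing the spoke [x] would be adjacent to both [a] and [b], hence be both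
   its first and its last member. *)
have xl : x \notin F q (last w s).
  rewrite -(chain_trapped (@rep_off q) (adj_rep q) (z := x) (a := w) (s := s)) //.
    by apply: consec_path; [exact: ear_uniq E | exact: ear_path E].
  move=> r rp; apply/negP => /andP[qr xr].
  have ra : adj r a by apply: rep_adj xr xa; rewrite // eq_sym neH.
  have rb : adj r b by apply: rep_adj xr xb; rewrite // eq_sym neH.
  move: ra rb; rewrite adjA // adjB // => /eqP -> /eqP lw.
  by rewrite lw eqxx in wl.
have [z za zl] : exists2 z, z \in F q a & z \in F q (last w s).
  by apply: adj_rep; rewrite adj_sym adjA.
have zx : z != x by apply: contraNneq xl => <-.
have two v c d : c \in F q v -> d \in F q v -> c != d -> #|F q v| = 2.
  by move=> cv dv cd; apply/eqP; rewrite eqn_leq rep_le2 (card_ge2 cv dv).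
have a2 := two _ _ _ za xa zx; have b2 := two _ _ _ yb xb yx.
exists q => v; rewrite !inE -orbA => /or3P[/eqP -> //|/eqP -> //|vp].
by apply: (ear_spokes E _ _ qb yb yw a2 ya); rewrite ?inE.
Qed.

Lemma gate_spokes S : gate adj S -> exists q, forall v, v \in S -> #|F q v| = 2.
Proof.
elim=> {S} [S /induced_cycle_ear[a [b [p [ab E ->]]]]|
  H C C' p gH [q F2] cC cC' CC' sp up pH adjp adjpH]; first exact: cycle_spokes E.
have [H0 twH trH nsH] := gate_props adj_sym adj_irr gH.
have E := gate_ext_ear H0 cC cC' CC' sp up pH adjp adjpH.
exists q => v; rewrite inE => /orP[/F2 //|]; rewrite inE.
exact: gate_ext_spokes E _.
Qed.

(** All paths of the gate pass through [q]. At another centre they would share one direction, and a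
    path with two further spokes would have three; at [q] itself [spokes_no_claw] applies. *)
Lemma rep_no_claw q S : gate adj S -> (forall v, v \in S -> #|F q v| = 2) ->
  forall u v w, u \in S -> v \in S -> w \in S -> ~ form_claw eT (P u) (P v) (P w).
Proof.
move=> gS F2 u v w uS vS wS [c [a [a_inj [ca claw]]]].
have [_ _ trS _] := gate_props adj_sym adj_irr gS.
have onS r : r \in S -> q \in P r by move=> /F2 /(F_on (@rep_off q)).
have cov r i j : pedge (P r) c (a i) && pedge (P r) c (a j) ->
    (a i \in F c r) && (a j \in F c r).
  by case/andP=> /pedge_mem/andP[_ ir] /pedge_mem/andP[_ jr]; rewrite !mem_rep.
have {}claw i j : i != j -> [\/ (a i \in F c u) && (a j \in F c u),
    (a i \in F c v) && (a j \in F c v) | (a i \in F c w) && (a j \in F c w)].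
  by move=> /claw[] /cov h; [exact: Or31|exact: Or32|exact: Or33].
have no3 r x y z : x != y -> x != z -> y != z ->
    x \in F c r -> y \in F c r -> z \in F c r -> False.
  move=> xy xz yz xr yr; rewrite (pairE (rep_le2 c r) xr yr xy) !inE.
  by rewrite ![z == _]eq_sym (negPf xz) (negPf yz).
have aE i j : (a i == a j) = (i == j) by apply: inj_eq.
have [qc|qc] := eqVneq q c; last first.
  pose b := branch eT c q.
  have br r : r \in S -> b \in F c r by move=> rS; apply: mem_branches; rewrite ?onS.
  (* Two of the three spokes of the claw differ from the direction [b] of [q]. *)
  have [i [j [ij bi bj]]] : exists i j, [/\ i != j, b != a i & b != a j].
    pose i0 := @Ordinal 3 0 isT; pose i1 := @Ordinal 3 1 isT; pose i2 := @Ordinal 3 2 isT.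
    have [->|b0] := eqVneq b (a i0); first by exists i1, i2; rewrite !aE.
    have [->|b1] := eqVneq b (a i1); first by exists i0, i2; rewrite !aE.
    by exists i0, i1.
  by case: (claw i j ij) => /andP[] ir jr; apply: (no3 _ _ _ _ bi bj _ (br _ _) ir jr);
    rewrite ?aE.
have adjF := rep_adjE F2; rewrite -{c}qc in ca cov claw no3 *.
have no_claw r s t x y z : r \in S -> s \in S -> t \in S ->
    x != y -> y != z -> x != z -> (x \in F q r) && (y \in F q r) ->
    (y \in F q s) && (z \in F q s) -> (x \in F q t) && (z \in F q t) -> False.
  move=> rS sS tS xy yz xz /andP[xr yr] /andP[ys zs] /andP[xt zt].
  apply: (spokes_no_claw adj_sym adj_irr adjF trS rS sS tS xy yz) => //.
  - by rewrite eq_sym.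
  - exact: (spokes_pair F2).
  - exact: (spokes_pair F2).
  - by apply: (spokes_pair F2); rewrite // eq_sym.
pose i0 := @Ordinal 3 0 isT; pose i1 := @Ordinal 3 1 isT; pose i2 := @Ordinal 3 2 isT.
have [n01 n12 n02] : [/\ a i0 != a i1, a i1 != a i2 & a i0 != a i2] by rewrite !aE.
have bad1 r : (a i0 \in F q r) && (a i1 \in F q r) ->
    (a i1 \in F q r) && (a i2 \in F q r) -> False.
  by case/andP=> h0 h1 /andP[_ h2]; apply: no3 n01 n02 n12 h0 h1 h2.
have bad2 r : (a i0 \in F q r) && (a i1 \in F q r) ->
    (a i0 \in F q r) && (a i2 \in F q r) -> False.
  by case/andP=> h0 h1 /andP[_ h2]; apply: no3 n01 n02 n12 h0 h1 h2.
have bad3 r : (a i1 \in F q r) && (a i2 \in F q r) ->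
    (a i0 \in F q r) && (a i2 \in F q r) -> False.
  by case/andP=> h1 h2 /andP[h0 _]; apply: no3 n01 n02 n12 h0 h1 h2.
(* One path covering two of the pairs would contain three spokes, so the three pairs belong to
   different paths. *)
case: (claw i0 i1 isT) => h01; case: (claw i1 i2 isT) => h12;
  case: (claw i0 i2 isT) => h02;
  first [exact: bad1 h01 h12 | exact: bad2 h01 h02 | exact: bad3 h12 h02
        | exact: (no_claw _ _ _ _ _ _ _ _ _ n01 n12 n02 h01 h12 h02)].
Qed.

Lemma gate_multipie S : gate adj S ->
  exists q (qs : 'I_(num_cliques adj S) -> W), multipie eT q qs P S.
Proof.
move=> gS; have [q F2] := gate_spokes gS; exists q.
have [S0 twS trS nsS] := gate_props adj_sym adj_irr gS.
have adjF := rep_adjE F2.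
have onS r : r \in S -> q \in P r by move=> /F2 /(F_on (@rep_off q)).
have nE := num_cliques_spokes adj_sym adj_irr F2 adjF twS trS nsS S0.
(* The neighbours of the pie enumerate the used spokes, which are as many as the cliques. *)
pose qs i := enum_val (cast_ord nE i); exists qs.
have usedP i : exists2 v, v \in S & qs i \in F q v.
  by have := enum_valP (cast_ord nE i); rewrite inE => /exists_inP.
have qs_inj : injective qs by move=> i j /enum_val_inj /cast_ord_inj.
have nbr i : eT q (qs i) by have [v _ /(branches_nbr treeT)] := usedP i.
have memE v i : v \in S -> (qs i \in P v) = (qs i \in F q v).
  by move=> vS; apply/idP/idP; [exact: mem_rep | exact: rep_mem (onS _ vS)].
split.
- by [].
- move=> v vS; rewrite -(F2 v vS) -(card_imset _ qs_inj); congr #|pred_of_set _|.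
  apply/setP => x; apply/imsetP/idP => [[i]|xv]; first by rewrite inE memE // => ? ->.
  have xU : x \in used_spokes (fun v => F q v) S by rewrite inE; apply/exists_inP; exists v.
  exists (cast_ord (esym nE) (enum_rank_in xU x)).
    by rewrite inE memE // /qs cast_ordKV enum_rankK_in.
  by rewrite /qs cast_ordKV enum_rankK_in.
- move=> i j ij; rewrite leqNgt; apply/negP => /card_gt1P[u [v []]].
  rewrite !inE => /and3P[uS iu ju] /and3P[vS iv jv] /eqP[].
  by apply: (spokes_meet1 F2 adjF twS uS vS (x := qs i) (y := qs j));
    rewrite -?memE // (inj_eq qs_inj).
- move=> i; have [v vS iv] := usedP i.
  have [w [wS wv iw]] := spokes_other adj_irr F2 adjF nsS vS iv.
  by apply/card_gt1P; exists w, v; rewrite !inE !onS ?memE // vS wS.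
- by move=> u v w uS vS wS _ _ _; exact: (rep_no_claw gS F2).
Qed.

End Representation.

Theorem theorem8 (V : finType) (adj : rel V)
    (adj_sym : symmetric adj) (adj_irr : irreflexive adj)
    (W : finType) (eT : rel W) (P : V -> seq W)
    (hEPT : EPT_rep eT adj P)
    (S : {set V}) (k : nat)
    (hgate : gate adj S) (hk : num_cliques adj S = k) :
  exists (q : W) (qs : 'I_k -> W), multipie eT q qs P S.
Proof. by rewrite -hk; apply: gate_multipie. Qed.
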